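(* Let $\mathcal{X}$ be a Polish space with its Borel $\sigma$-algebra, and let $\overline{\mathcal{P}}(\mathcal{X})$ be the collection of all nonempty, weakly compact, convex sets of Borel probability measures on $\mathcal{X}$. Let $\mathcal{P},\mathcal{Q}\in\overline{\mathcal{P}}(\mathcal{X})$. Then: (i) $\mathrm{KL}(\mathcal{P}\parallel\mathcal{Q})\ge 0$; (ii) $\mathrm{KL}(\mathcal{P}\parallel\mathcal{Q})=0$ if and only if $\mathcal{P}\subseteq\mathcal{Q}$; (iii) $\mathrm{KL}(\mathcal{P}\parallel\mathcal{Q})=0$ and $\mathrm{KL}(\mathcal{Q}\parallel\mathcal{P})=0$ if and only if $\mathcal{P}=\mathcal{Q}$; (iv) for all $\mathcal{Q}_1,\mathcal{Q}_2\in\overline{\mathcal{P}}(\mathcal{X})$ with $\mathcal{Q}_1\subseteq\mathcal{Q}_2$, $\mathrm{KL}(\mathcal{P}\parallel\mathcal{Q}_1)\ge\mathrm{KL}(\mathcal{P}\parallel\mathcal{Q}_2)$; and for all $\mathcal{P}_1,\mathcal{P}_2\in\overline{\mathcal{P}}(\mathcal{X})$ with $\mathcal{P}_1\subseteq\mathcal{P}_2$, $\mathrm{KL}(\mathcal{P}_2\parallel\mathcal{Q})\ge\mathrm{KL}(\mathcal{P}_1\parallel\mathcal{Q})$; (v) $\mathrm{KL}(\cdot\parallel\cdot)$ is (jointly) convex: for all $\mathcal{P}_1,\mathcal{P}_2,\mathcal{Q}_1,\mathcal{Q}_2\in\overline{\mathcal{P}}(\mathcal{X})$ and $\lambda_1,\lambda_2\in[0,1]$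 with $\lambda_1+\lambda_2=1$, $$\mathrm{KL}(\lambda_1\mathcal{P}_1+\lambda_2\mathcal{P}_2\parallel\lambda_1\mathcal{Q}_1+\lambda_2\mathcal{Q}_2)\le\lambda_1\mathrm{KL}(\mathcal{P}_1\parallel\mathcal{Q}_1)+\lambda_2\mathrm{KL}(\mathcal{P}_2\parallel\mathcal{Q}_2).$$
   Context: ''Weakly compact'' means compact in the topology of weak convergence of probability measures. For probability measures $\mu,\nu$, $\mathrm{KL}(\mu\parallel\nu)=\int_{\mathcal{X}}\log\left(\frac{d\mu}{d\nu}\right)d\mu$ (natural logarithm) if $\mu\ll\nu$, and $+\infty$ otherwise. For sets of probability measures, $\mathrm{KL}(\mathcal{P}\parallel\mathcal{Q}):=\sup_{\mu\in\mathcal{P}}\inf_{\nu\in\mathcal{Q}}\mathrm{KL}(\mu\parallel\nu)$, with values in the extended reals. Convex combinations of sets are $\lambda_1\mathcal{P}_1+\lambda_2\mathcal{P}_2:=\{\lambda_1\mu_1+\lambda_2\mu_2:\mu_1\in\mathcal{P}_1,\mu_2\in\mathcal{P}_2\}$. Convention: $0\cdot(+\infty)=0$. *)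

(* Defs.v *)
From HB Require Import structures.
From mathcomp Require Import all_boot all_order all_algebra.
From mathcomp Require Import all_classical all_reals all_analysis.

Set Implicit Arguments.
Unset Strict Implicit.
Unset Printing Implicit Defensive.

Import Order.TTheory GRing.Theory Num.Theory.
Import numFieldNormedType.Exports.

Local Open Scope classical_set_scope.
Local Open Scope ring_scope.
Local Open Scope charge_scope.

(* The metric is only asserted to exist: a Polish space is a topological space,
   and no particular metric is part of the data. *)
Definition polish_space (R : realType) (X : topologicalType) : Prop :=
  (exists dist : X -> X -> R,
     [/\ (forall x y, 0 <= dist x y) /\ (forall x y, dist x y = 0 <-> x = y),
         forall x y, dist x y = dist y x,
         forall x y z, dist x z <= dist x y + dist y z,
         (forall (x : X) (A : set X), nbhs x A <->
           exists2 e : R, 0 < e & [set y | dist x y < e] `<=` A) &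
         forall u : nat -> X,
           (forall e : R, 0 < e -> exists N : nat, forall m n : nat,
             (N <= m)%N -> (N <= n)%N -> dist (u m) (u n) < e) ->
           exists l : X, u @ \oo --> l]) /\
  (exists2 D : set X, countable D & dense D).

(* The base point is required by g_sigma_algebraType and plays no role: an empty
   space carries no probability measure. *)
Notation borel X := (g_sigma_algebraType (@open X)).

(* A library probability is a function on all of set X, constrained only on
   measurable sets, so that a given Borel probability measure is represented by
   many distinct terms. Requiring the value 0 off the Borel sets selects exactly
   one representative, which makes Leibniz equality, membership and inclusion of
   sets of measures have their usual meaning; see borelProb_ext and
   borelProb_repr. *)
Record borelProb (R : realType) (X : ptopologicalType) := BorelProb {
  bprob :> probability (borel X) R ;
  bprob_nonmeasurable : forall A : set (borel X),
    ~ measurable A -> bprob A = 0%E }.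

HB.instance Definition _ R X := gen_eqMixin (borelProb R X).
HB.instance Definition _ R X := gen_choiceMixin (borelProb R X).

Section borelProb_theory.
Context {R : realType} {X : ptopologicalType}.
Implicit Types mu nu : borelProb R X.

Lemma borelProb_ext mu nu :
  (forall A : set (borel X), measurable A -> mu A = nu A) -> mu = nu.
Proof.
case: mu nu => [[m c] hm] [[m' c'] hm'] /= E.
have {}E : m = m'.
  apply/funext => A; have [mA|mA] := pselect (measurable A); first exact: E.
  by have /= -> := hm _ mA; have /= -> := hm' _ mA.
subst m'.
have {}E : c = c'.
  case: c c' {hm hm'} => [[a1 a2] [a3] [a4] [a5] [a6] [a7] [a8]].
  case=> [[b1 b2] [b3] [b4] [b5] [b6] [b7] [b8]].
  by rewrite (Prop_irrelevance b1 a1) (Prop_irrelevance b2 a2)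
    (Prop_irrelevance b3 a3) (Prop_irrelevance b4 a4) (Prop_irrelevance b5 a5)
    (Prop_irrelevance b6 a6) (Prop_irrelevance b7 a7) (Prop_irrelevance b8 a8).
by subst c'; congr BorelProb; exact: Prop_irrelevance.
Qed.

Lemma borelProb_repr (P : probability (borel X) R) :
  exists mu, forall A : set (borel X), measurable A -> mu A = P A.
Proof.
pose m (A : set (borel X)) := (if `[< measurable A >] then P A else 0)%E.
have mE A : measurable A -> m A = P A by move=> mA; rewrite /m asboolT.
have m0 : m set0 = 0%E by rewrite mE// measure0.
have m_ge0 A : (0 <= m A)%E by rewrite /m; case: ifPn.
have m_sa : semi_sigma_additive m.
  move=> F mF tF mUF; rewrite mE//.
  under eq_fun do under eq_bigr do rewrite mE//.
  exact: measure_semi_sigma_additive.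
pose mm := isMeasure.Build _ _ _ m m0 m_ge0 m_sa.
pose M : {measure set (borel X) -> \bar R} := HB.pack m mm.
have m1 : M setT = 1%E by rewrite /= mE// probability_setT.
pose pp := Measure_isProbability.Build _ _ _ M m1.
pose Q : probability (borel X) R := HB.pack m M pp.
have Q0 (A : set (borel X)) : ~ measurable A -> Q A = 0%E.
  by move=> mA; rewrite /= /m asboolF.
by exists (BorelProb Q0) => A /mE.
Qed.

Definition bounded_continuous : set (X -> R^o) :=
  [set f | continuous f /\ bounded_fun f].

Definition weak_embedding mu : {ptws set_type bounded_continuous -> R^o} :=
  fun f => Rintegral mu setT (set_val f).

(* The topology of weak convergence: the coarsest topology for which the maps
   mu |-> \int f dmu are continuous, f bounded and continuous. *)
HB.instance Definition _ :=
  Topological.copy (borelProb R X) (initial_topology weak_embedding).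

Lemma weak_cvgP (F : set_system (borelProb R X)) mu : Filter F ->
  F --> mu <-> forall f : X -> R^o, continuous f -> bounded_fun f ->
    (fun nu => Rintegral nu setT f) @ F --> Rintegral mu setT f.
Proof.
move=> FF; split=> [Fmu f fc fb A|H A].
  have bf : bounded_continuous f by [].
  pose g : set_type bounded_continuous := exist _ f (mem_set bf).
  rewrite nbhsE => -[B [oB Bmu] BA].
  apply: filterS (Fmu ((weak_embedding ^~ g) @^-1` B) _).
    by move=> nu /BA.
  apply: open_nbhs_nbhs; split => //=.
  exists ((fun h : {ptws set_type bounded_continuous -> R^o} => h g) @^-1` B) => //.
  move: B oB {Bmu BA}; apply/continuousP.
  exact: (@proj_continuous _ (fun=> R^o) g).
have H2 : weak_embedding @ F --> weak_embedding mu.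
  apply/cvg_sup => -[f fP] B [_] [[/= C oC <-] Cmu] CB.
  have [fc fb] := set_mem fP.
  apply: filterS CB _; apply: (H f fc fb C).
  exact: open_nbhs_nbhs.
rewrite nbhsE => -[B [[C oC <-] Cmu] BA].
by apply: filterS BA _; apply: H2; exact: open_nbhs_nbhs.
Qed.

(* The set l1 P1 + l2 P2: for nonnegative l1, l2 of sum 1, each pair mu1, mu2
   contributes exactly one mu, by mixture_exists and borelProb_ext. *)
Definition mixture (l1 l2 : R) (P1 P2 : set (borelProb R X)) :
    set (borelProb R X) :=
  [set mu | exists2 mu1, P1 mu1 & exists2 mu2, P2 mu2 &
    forall A : set (borel X), mu A = (l1%:E * mu1 A + l2%:E * mu2 A)%E].

Lemma mixture_exists (l1 l2 : R) mu1 mu2 : 0 <= l1 -> 0 <= l2 -> l1 + l2 = 1 ->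
  exists mu, mixture l1 l2 [set mu1] [set mu2] mu.
Proof.
move=> l10 l20 l12.
pose M : {measure set (borel X) -> \bar R} :=
  measure_add (mscale (NngNum l10) mu1) (mscale (NngNum l20) mu2).
have ME A : M A = (l1%:E * mu1 A + l2%:E * mu2 A)%E.
  exact: measure_addE.
have m1 : M setT = 1%E by rewrite ME !probability_setT !mule1 -EFinD l12.
pose Q : probability (borel X) R := mnormalize M mu1.
have QM A : Q A = M A.
  by rewrite /Q /= /mnormalize m1 eqe oner_eq0/= invr1 mule1.
have Q0 (A : set (borel X)) : ~ measurable A -> Q A = 0%E.
  by move=> mA; rewrite QM ME !bprob_nonmeasurable// !mule0 adde0.
exists (BorelProb Q0); exists mu1 => //; exists mu2 => // A.
by rewrite /= -ME -QM.
Qed.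

Definition convex_probs (P : set (borelProb R X)) : Prop :=
  forall l : R, 0 <= l <= 1 -> mixture l (1 - l) P P `<=` P.

Definition weakly_compact_convex : set (set (borelProb R X)) :=
  [set P | [/\ P !=set0, compact P & convex_probs P]].

End borelProb_theory.

(* The derivative is determined up to a nu-null, hence mu-null, set, and the
   negative part of the integrand is mu-integrable, so the integral is never
   of the form +oo - oo. *)
Definition KL d (T : measurableType d) (R : realType)
    (mu nu : probability T R) : \bar R :=
  (if `[< mu `<< nu >]
   then \int[mu]_x lne (('d (charge_of_finite_measure mu) '/d nu) x)
   else +oo)%E.

Definition KL_set (R : realType) (X : ptopologicalType)
    (P Q : set (borelProb R X)) : \bar R :=
  ereal_sup [set ereal_inf [set KL mu nu | nu in Q] | mu in P].

(* Main.v *)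
Require Import Defs.
From mathcomp Require Import all_boot all_order all_algebra.
From mathcomp Require Import all_classical all_reals all_analysis.
From mathcomp Require Import measurable_realfun ring lra.

(** Both convexity and the passage from KL = 0 to inclusion rest on one
    inequality. With y = dmu/dnu, Young's inequality y ln v <= (y ln y - y + 1)
    + v - 1, applied pointwise and integrated against nu, gives the variational
    bound
      \int ln g dmu <= KL(mu || nu) + \int g dnu - 1
    for nonnegative measurable g vanishing only on a mu-null set
    ([gibbs_variational]), once KL has been rewritten as \int (y ln y - y + 1)
    dnu, a nonnegative integral ([KL_entropy_integral]). To avoid any
    integrability question about ln g, the bound is stated with the positive and
    negative parts of ln g on opposite sides, so that all integrals are
    nonnegative extended reals.

    Two choices of g do the work. When mu and nu are mixtures of mu1, mu2 and of
    nu1, nu2, take g = dmu/dnu in the bounds for the pairs (mu1, nu1) and (mu2,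
    nu2): the weighted sum of the left-hand sides is KL(mu || nu), and that of
    the \int g dnu_i is \int g dnu = 1. This is joint convexity
    ([KL_jointly_convex]). For a bounded h, take g = exp(s h) with s small:
    since exp(s h) <= 1 + s h + O(s^2), KL(mu || nu) controls \int h dmu - \int
    h dnu ([KL_small_integral_close]), which is a weak form of Pinsker's
    inequality.

    The only delicate part of the theorem is that KL(P || Q) = 0 implies that P
    is included in Q. Given mu in P, there are measures in Q of arbitrarily
    small divergence from mu. By compactness they have a weak cluster point nu
    in Q, and by the Pinsker-type bound mu and nu integrate every bounded
    continuous function alike, so mu = nu because on a metrizable space these
    integrals determine a Borel probability measure
    ([borelProb_eq_bounded_continuous]). Conversely KL(mu || mu) = 0. The other
    claims are formal properties of suprema and infima; in the convexity claim
    weights equal to 0 are treated apart, where the mixture of two sets is just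
    one of them. *)

Set Implicit Arguments.
Unset Strict Implicit.
Unset Printing Implicit Defensive.

Import Order.TTheory GRing.Theory Num.Theory.
Import numFieldNormedType.Exports.
Local Open Scope classical_set_scope.
Local Open Scope ring_scope.

(** * The integrand y ln y - y + 1 *)

Section entropy_integrand.
Context {R : realType}.
Implicit Types y v x : R.

(** The shift by - y + 1 makes the integrand of KL nonnegative and does not
    change its integral, since a density integrates to 1. *)
Definition entropy_integrand y : R := y * ln y - y + 1.

(** Fenchel-Young: z |-> exp z is the convex conjugate of y |-> y ln y - y,
    evaluated here at z = ln v. It is 1 + z <= exp z at z = ln v - ln y,
    multiplied by y. *)
Lemma young_ln y v : 0 <= y -> 0 < v -> y * ln v + 1 <= entropy_integrand y + v.
Proof.
rewrite /entropy_integrand le_eqVlt => /predU1P[<-|y0] v0.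
  by rewrite !mul0r; lra.
have := expR_ge1Dx (ln v - ln y).
rewrite expRB !lnK// => /(ler_wpM2l (ltW y0)).
rewrite mulrCA divff ?gt_eqF// mulr1; lra.
Qed.

Lemma entropy_integrand_ge0 y : 0 <= y -> 0 <= entropy_integrand y.
Proof. by move=> /young_ln /(_ ltr01); rewrite ln1 mulr0; lra. Qed.

Lemma entropy_integrand0 : entropy_integrand 0 = 1.
Proof. by rewrite /entropy_integrand mul0r; lra. Qed.

Lemma entropy_integrand1 : entropy_integrand 1 = 0.
Proof. by rewrite /entropy_integrand ln1; lra. Qed.

Lemma measurable_entropy_integrand : measurable_fun setT entropy_integrand.
Proof.
apply: measurable_funD => //; apply: measurable_funB => //.
by apply: measurable_funM => //; exact: measurable_ln.
Qed.

(** From exp (- x) >= 1 - x one gets exp x <= 1 / (1 - x), and the quadratic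
    bounds this fraction when |x| <= 1/2. *)
Lemma expR_le_quadratic x : `|x| <= 2^-1 -> expR x <= 1 + x + 2 * x ^+ 2.
Proof.
rewrite ler_norml => /andP[x1 x2].
have x0 : 0 < 1 - x by lra.
have : expR x * (1 - x) <= 1.
  have := expR_ge1Dx (- x) => /(ler_wpM2l (expR_ge0 x)).
  by rewrite expRN divff ?gt_eqF ?expR_gt0.
rewrite -ler_pdivlMr// => /le_trans; apply.
rewrite ler_pdivrMr//; nra.
Qed.

Lemma max0_subE x : x = Num.max x 0 - Num.max (- x) 0.
Proof. by case: (leP x 0) => ?; case: (leP (- x) 0) => ?; lra. Qed.

End entropy_integrand.

(** * Kullback-Leibler divergence of two probability measures *)

Section kullback_leibler.
Context d (T : measurableType d) (R : realType).
Implicit Types (mu nu : probability T R) (g h : T -> R).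
Local Open Scope ereal_scope.

Local Notation lnpos g := (fun x => (Num.max (ln (g x)) 0)%:E).
Local Notation lnneg g := (fun x => (Num.max (- ln (g x)) 0)%:E).

Lemma measurable_lnpos g : measurable_fun setT g -> measurable_fun setT (lnpos g).
Proof.
move=> mg; apply/measurable_EFinP; apply: measurable_maxr => //.
by apply: measurableT_comp => //; exact: measurable_ln.
Qed.

Lemma measurable_lnneg g : measurable_fun setT g -> measurable_fun setT (lnneg g).
Proof.
move=> mg; apply/measurable_EFinP; apply: measurable_maxr => //.
by do 2 (apply: measurableT_comp => //).
Qed.

(** The change of variables formula for all nonnegative integrands, rather than
    for indicator functions only, is what every use of the density needs. *)
Definition is_density mu nu (y : T -> R) :=
  [/\ measurable_fun setT y, forall x, (0 <= y x)%R &
     forall f E, (forall x, 0 <= f x) -> measurable E -> measurable_fun E f ->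
       \int[mu]_(x in E) f x = \int[nu]_(x in E) (f x * (y x)%:E)].

Lemma measurable_zeros g : measurable_fun setT g ->
  measurable (g @^-1` [set 0%R]).
Proof. by move=> mg; rewrite -[X in measurable X]setTI; exact: mg. Qed.

Lemma density_null mu nu y : is_density mu nu y -> mu (y @^-1` [set 0%R]) = 0.
Proof.
move=> [my y0 muE]; have mZ := measurable_zeros my.
rewrite -[LHS]mul1e -(integral_cst _ mZ) muE//.
by rewrite integral0_eq// => x /= ->; rewrite mule0.
Qed.

(** A real-valued, everywhere nonnegative version of the Radon-Nikodym
    derivative. It vanishes only on a mu-null set, where the extended logarithm
    in KL is -oo and the real one is 0, so both have the same mu-integral. *)
Lemma dominated_density mu nu : mu `<< nu ->
  exists2 y, is_density mu nu y & KL mu nu = \int[mu]_x (ln (y x))%:E.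
Proof.
move=> munu; pose f := Radon_Nikodym_SigmaFinite.f mu nu.
have f0 := Radon_Nikodym_SigmaFinite.f_ge0 munu.
have ffin := Radon_Nikodym_SigmaFinite.f_fin_num munu.
have mf : measurable_fun setT f.
  exact: measurable_int (Radon_Nikodym_SigmaFinite.f_integrable munu).
have my : measurable_fun setT (fine \o f) by exact: measurableT_comp.
have dy : is_density mu nu (fine \o f).
  split => //.
  - by move=> x; apply: fine_ge0; exact: f0.
  - move=> F E F0 mE mF.
    rewrite -(Radon_Nikodym_SigmaFinite.change_of_variables munu)//.
    by apply: eq_integral => x _ /=; rewrite fineK//; exact: ffin.
exists (fine \o f) => //.
rewrite /KL asboolT//; apply: ae_eq_integral => //.
- pose r := Radon_Nikodym (charge_of_finite_measure mu) nu.
  have rfin x : r x \is a fin_num by exact: Radon_Nikodym_fin_num.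
  have -> : (fun x => lne (r x)) = (fun x =>
      if (fine (r x) <= 0)%R then -oo else (ln (fine (r x)))%:E).
    by apply/funext => x; rewrite -{1}(fineK (rfin x)).
  have mr : measurable_fun setT (fine \o r).
    apply: measurableT_comp => //.
    by apply: (measurable_int nu); exact: Radon_Nikodym_integrable.
  apply: measurable_fun_ifT => //; first exact: measurable_fun_ler.
  by apply/measurable_EFinP; apply: measurableT_comp => //; exact: measurable_ln.
- apply/measurable_EFinP; apply: measurableT_comp => //; exact: measurable_ln.
- have := null_dominates_ae_eq measurableT munu
    (ae_eq_Radon_Nikodym_SigmaFinite munu measurableT).
  have : {ae mu, forall x, fine (f x) != 0%R}.
    exists ((fine \o f) @^-1` [set 0%R]); split => //.
    + exact: measurable_zeros.
    + exact: density_null dy.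
    + by move=> x /= /negP/negPn/eqP.
  apply: filterS2 => x yx0 /(_ Logic.I) <- _.
  rewrite -(fineK (ffin x)) lne_EFin//=.
  by rewrite lt_neqAle eq_sym yx0 fine_ge0//; exact: f0.
Qed.

Lemma integral_cst1 nu : \int[nu]_x cst 1 x = 1 :> \bar R.
Proof.
by rewrite integral_cst// mul1e; exact: probability_setT. Qed.

(** The negative part of y ln y is bounded (y ln y >= y - 1 >= - 1), so KL is
    never of the form +oo - +oo. *)
Lemma lnneg_density_le1 mu nu y : is_density mu nu y ->
  \int[mu]_x lnneg y x <= 1.
Proof.
move=> [my y0 muE]; rewrite muE//; last 2 first.
- by move=> x; rewrite lee_fin le_max lexx orbT.
- exact: measurable_lnneg.
rewrite -[leRHS](integral_cst1 nu).
apply: ge0_le_integral => //.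
- by move=> x _; rewrite -EFinM lee_fin mulr_ge0// le_max lexx orbT.
- by apply: emeasurable_funM; [exact: measurable_lnneg|exact/measurable_EFinP].
- move=> x _; rewrite -EFinM lee_fin maxr_pMl// mul0r ge_max ler01 andbT.
  have := entropy_integrand_ge0 (y0 x); have := y0 x.
  rewrite /entropy_integrand. lra.
Qed.

Lemma integral_density mu nu y : is_density mu nu y ->
  \int[nu]_x (y x)%:E = 1.
Proof.
move=> [my y0 muE]; rewrite -(integral_cst1 mu) muE//.
by under [RHS]eq_integral do rewrite mul1e.
Qed.

Lemma integral_lnE mu g : measurable_fun setT g ->
  \int[mu]_x (ln (g x))%:E = \int[mu]_x lnpos g x - \int[mu]_x lnneg g x.
Proof.
move=> mg; rewrite integralE; congr (_ - _); apply: eq_integral => x _.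
- by rewrite funeposE EFin_max.
- by rewrite funenegE EFin_max.
Qed.

(** The mu-integral of ln y becomes the nu-integral of y ln y, which may be +oo;
    hence the identity is obtained by moving negative terms across the equation
    (ln y)^+ y + 1 = (y ln y - y + 1) + y + (ln y)^- y and integrating
    nonnegative functions only. *)
Lemma KL_entropy_integral mu nu : mu `<< nu ->
  exists2 y, is_density mu nu y &
    KL mu nu = \int[nu]_x (entropy_integrand (y x))%:E.
Proof.
move=> /dominated_density[y dy ->]; exists y => //.
have [my y0 muE] := dy.
have mlp := measurable_lnpos my; have mln := measurable_lnneg my.
have lp0 x : 0 <= lnpos y x by rewrite lee_fin le_max lexx orbT.
have ln0 x : 0 <= lnneg y x by rewrite lee_fin le_max lexx orbT.
have me : measurable_fun setT (fun x => (entropy_integrand (y x))%:E).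
  apply/measurable_EFinP; apply: measurableT_comp => //.
  exact: measurable_entropy_integrand.
have e0 x : 0 <= (entropy_integrand (y x))%:E.
  by rewrite lee_fin entropy_integrand_ge0.
have mey : measurable_fun setT (EFin \o y) by exact/measurable_EFinP.
have I1 : \int[mu]_x lnpos y x + 1 =
    \int[nu]_x (entropy_integrand (y x))%:E + 1 + \int[mu]_x lnneg y x.
  rewrite (muE (lnpos y))// (muE (lnneg y))// -{2}(integral_density dy).
  have -> : 1 = \int[nu]_x cst 1 x :> \bar R.
    exact/esym/integral_cst1.
  have mpy : measurable_fun setT (fun x => lnpos y x * (y x)%:E).
    exact: emeasurable_funM.
  have mny : measurable_fun setT (fun x => lnneg y x * (y x)%:E).
    exact: emeasurable_funM.
  have yE0 x : 0 <= (y x)%:E by rewrite lee_fin.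
  rewrite -!ge0_integralD//; last 4 first.
  - by move=> x _; rewrite adde_ge0.
  - exact: emeasurable_funD.
  - by move=> x _; rewrite mule_ge0.
  - by move=> x _; rewrite mule_ge0.
  apply: eq_integral => x _.
  rewrite -!EFinM -!EFinD; congr (_%:E); rewrite /entropy_integrand.
  by have := max0_subE (ln (y x)); move: (Num.max _ _) (Num.max _ _) => p n ->; ring.
move: I1; have : \int[mu]_x lnneg y x \is a fin_num.
  rewrite ge0_fin_numE ?integral_ge0//.
  exact: le_lt_trans (lnneg_density_le1 dy) (ltry _).
rewrite (integral_lnE mu my).
case: (X in X \is a fin_num -> _) => // n _.
case: (\int[mu]_x lnpos y x) => [p| |]; case: (\int[nu]_x _) => [e| |]//.
by rewrite -!EFinD => -[pe]; congr (_%:E); lra.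
Qed.

Lemma ge0_neqNy (x : \bar R) : 0 <= x -> x != -oo.
Proof. by case: x. Qed.

Lemma KL_lty_dominated mu nu : KL mu nu < +oo -> mu `<< nu.
Proof. by rewrite /KL; case: asboolP. Qed.

Lemma KL_ge0 mu nu : 0 <= KL mu nu.
Proof.
have [munu|munu] := pselect (mu `<< nu); last by rewrite /KL asboolF.
have [y [_ y0 _] ->] := KL_entropy_integral munu.
by apply: integral_ge0 => x _; rewrite lee_fin entropy_integrand_ge0.
Qed.

Lemma KLxx mu : KL mu mu = 0.
Proof.
have [y [my y0 muE] ->] :=
  KL_entropy_integral (fun A : set T => @id (null_set mu A)).
(* The density of mu with respect to itself is 1 almost everywhere. *)
have y1 : ae_eq mu setT (EFin \o y) (cst 1).
  apply/ae_eq_sym/integral_ae_eq => //.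
  - exact: finite_measure_integrable_cst.
  - exact/measurable_EFinP.
  - move=> E _ mE; rewrite muE//.
    by apply: eq_integral => x _; rewrite mul1e.
rewrite (ae_eq_integral (cst 0))//; first by rewrite integral0.
- apply/measurable_EFinP; apply: measurableT_comp => //.
  exact: measurable_entropy_integrand.
- by apply: filterS y1 => x /(_ Logic.I)[-> _]; rewrite entropy_integrand1.
Qed.

(** Integrate [young_ln] with v = g x. Where g vanishes, ln v carries no
    information, but there the density y is 0 nu-almost everywhere, since
    mu does not charge this set, and both sides are then equal to 1. *)
Lemma gibbs_variational mu nu g : measurable_fun setT g ->
  (forall x, 0 <= g x)%R -> mu (g @^-1` [set 0%R]) = 0 ->
  \int[mu]_x lnpos g x + 1 <=
    KL mu nu + \int[nu]_x (g x)%:E + \int[mu]_x lnneg g x.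
Proof.
move=> mg g0 g_null.
have lp0 x : 0 <= lnpos g x by rewrite lee_fin le_max lexx orbT.
have ln0 x : 0 <= lnneg g x by rewrite lee_fin le_max lexx orbT.
have gE0 x : 0 <= (g x)%:E by rewrite lee_fin.
have [munu|munu] := pselect (mu `<< nu); last first.
  by rewrite {1}/KL asboolF// !addye ?leey// ge0_neqNy// integral_ge0.
have mlp := measurable_lnpos mg; have mln := measurable_lnneg mg.
have mgE : measurable_fun setT (EFin \o g) by exact/measurable_EFinP.
have [y [my y0 muE] ->] := KL_entropy_integral munu.
have mey : measurable_fun setT (EFin \o y) by exact/measurable_EFinP.
have yE0 x : 0 <= (y x)%:E by rewrite lee_fin.
have me : measurable_fun setT (fun x => (entropy_integrand (y x))%:E).
  apply/measurable_EFinP; apply: measurableT_comp => //.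
  exact: measurable_entropy_integrand.
have e0 x : 0 <= (entropy_integrand (y x))%:E.
  by rewrite lee_fin entropy_integrand_ge0.
have mZ := measurable_zeros mg.
have yZ : ae_eq nu (g @^-1` [set 0%R]) (EFin \o y) (cst 0).
  apply/(ae_eq_integral_abs _ mZ); first exact: measurable_funTS.
  transitivity (\int[nu]_(x in g @^-1` [set 0%R]) (cst 1 x * (y x)%:E)).
    by apply: eq_integral => x _; rewrite mul1e gee0_abs//=.
  by rewrite -muE// integral_cst// [X in _ * X]g_null mule0.
have mpy : measurable_fun setT (fun x => lnpos g x * (y x)%:E).
  exact: emeasurable_funM.
have mny : measurable_fun setT (fun x => lnneg g x * (y x)%:E).
  exact: emeasurable_funM.
rewrite (muE (lnpos g))// (muE (lnneg g))// -(integral_cst1 nu).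
rewrite -!ge0_integralD//; last 4 first.
- by move=> x _; rewrite adde_ge0.
- exact: emeasurable_funD.
- by move=> x _; rewrite mule_ge0.
- by move=> x _; rewrite mule_ge0.
apply: ae_ge0_le_integral => //.
- by move=> x _; rewrite adde_ge0// mule_ge0.
- exact: emeasurable_funD.
- by move=> x _; rewrite !adde_ge0// mule_ge0.
- by apply: emeasurable_funD => //; exact: emeasurable_funD.
apply: filterS yZ => x yx0 _.
rewrite -!EFinM -!EFinD lee_fin.
have [gx0|gx0] := eqVneq (g x) 0%R.
  have [->] := yx0 gx0.
  by rewrite entropy_integrand0 gx0 !mulr0 !addr0 add0r.
have gx_gt0 : (0 < g x)%R by rewrite lt_neqAle eq_sym gx0 g0.
have := young_ln (y0 x) gx_gt0.
have := max0_subE (ln (g x)).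
by move: (Num.max _ _) (Num.max _ _) => p n ->; lra.
Qed.

Lemma fin_num_ge0_addlty (l : R) (x y : \bar R) : (0 < l)%R ->
  0 <= x -> 0 <= y ->
  l%:E * x + y < +oo -> x \is a fin_num.
Proof.
move=> l0; case: x => //= _ y0.
by rewrite gt0_muley ?lte_fin// addye// ge0_neqNy.
Qed.

Lemma ge0_integral_mixture (l1 l2 : R) mu mu1 mu2 (f : T -> \bar R) :
  (0 <= l1)%R -> (0 <= l2)%R ->
  (forall A, measurable A -> mu A = l1%:E * mu1 A + l2%:E * mu2 A) ->
  measurable_fun setT f -> (forall x, 0 <= f x) ->
  \int[mu]_x f x = l1%:E * \int[mu1]_x f x + l2%:E * \int[mu2]_x f x.
Proof.
move=> l10 l20 muE mf f0.
rewrite (eq_measure_integral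
  (measure_add (mscale (NngNum l10) mu1) (mscale (NngNum l20) mu2))).
  by rewrite ge0_integral_measure_add// !ge0_integral_mscale.
by move=> A mA _; apply: (etrans (muE A mA)); exact/esym/measure_addE.
Qed.

(** For g = dmu/dnu, each mu_i gives no mass to the zeros of g because mu does
    not and l1, l2 > 0; so [gibbs_variational] applies to both pairs. In the sum
    weighted by l1, l2 the terms \int g dnu_i add up to \int g dnu = 1 and cancel
    the constant l1 + l2 = 1. *)
Lemma KL_jointly_convex (l1 l2 : R) mu mu1 mu2 nu nu1 nu2 :
  (0 < l1)%R -> (0 < l2)%R -> (l1 + l2 = 1)%R ->
  (forall A, measurable A -> mu A = l1%:E * mu1 A + l2%:E * mu2 A) ->
  (forall A, measurable A -> nu A = l1%:E * nu1 A + l2%:E * nu2 A) ->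
  KL mu nu <= l1%:E * KL mu1 nu1 + l2%:E * KL mu2 nu2.
Proof.
move=> l10 l20 l12 muE nuE.
have [->|/eqP K1] := eqVneq (KL mu1 nu1) +oo.
  rewrite gt0_muley ?lte_fin// addye ?leey// ge0_neqNy//.
  by rewrite mule_ge0 ?KL_ge0// lee_fin ltW.
have [->|/eqP K2] := eqVneq (KL mu2 nu2) +oo.
  rewrite gt0_muley ?lte_fin// addey ?leey// ge0_neqNy//.
  by rewrite mule_ge0 ?KL_ge0// lee_fin ltW.
move: K1 K2 => /eqP; rewrite -ltey => K1 /eqP; rewrite -ltey => K2.
have null (m m1 m2 : probability T R) A :
    (forall A, measurable A -> m A = l1%:E * m1 A + l2%:E * m2 A) ->
    measurable A -> m A = 0 -> m1 A = 0 /\ m2 A = 0.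
  move=> mE mA; rewrite mE// => /eqP.
  rewrite padde_eq0 ?mule_ge0 ?lee_fin ?(ltW l10) ?(ltW l20)//.
  by rewrite !mule_eq0 !eqe (gt_eqF l10) (gt_eqF l20)/= => /andP[/eqP -> /eqP ->].
have munu : mu `<< nu.
  apply/null_content_dominatesP => A mA /(null nu nu1 nu2 _ nuE mA)[n1 n2].
  have := KL_lty_dominated K1 => /null_content_dominatesP/(_ _ mA n1) m1.
  have := KL_lty_dominated K2 => /null_content_dominatesP/(_ _ mA n2) m2.
  by rewrite muE// m1 m2 !mule0 adde0.
have [g dg KLE] := dominated_density munu.
have [mg g0 _] := dg.
have mZ := measurable_zeros mg.
have [Z1 Z2] := null mu mu1 mu2 _ muE mZ (density_null dg).
have := gibbs_variational nu1 mg g0 Z1.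
have := gibbs_variational nu2 mg g0 Z2.
have lp0 x : 0 <= lnpos g x by rewrite lee_fin le_max lexx orbT.
have ln0 x : 0 <= lnneg g x by rewrite lee_fin le_max lexx orbT.
have gE0 x : 0 <= (g x)%:E by rewrite lee_fin.
have mlp := measurable_lnpos mg; have mln := measurable_lnneg mg.
have mgE : measurable_fun setT (EFin \o g) by exact/measurable_EFinP.
have IG := ge0_integral_mixture (ltW l10) (ltW l20) nuE mgE gE0.
have IP := ge0_integral_mixture (ltW l10) (ltW l20) muE mlp lp0.
have IN := ge0_integral_mixture (ltW l10) (ltW l20) muE mln ln0.
rewrite KLE integral_lnE// IP IN.
rewrite (integral_density dg) in IG.
have := lnneg_density_le1 dg; rewrite IN.
have := KL_ge0 mu1 nu1; have := KL_ge0 mu2 nu2.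
move: IG K1 K2.
(* It remains to add the two bounds; finiteness of all terms turns this into
   linear arithmetic over the reals. *)
set P1 := \int[mu1]_x lnpos g x; set N1 := \int[mu1]_x lnneg g x.
set P2 := \int[mu2]_x lnpos g x; set N2 := \int[mu2]_x lnneg g x.
set G1 := \int[nu1]_x _; set G2 := \int[nu2]_x _.
have {IP IN} : [/\ 0 <= P1, 0 <= P2, 0 <= N1 & 0 <= N2].
  by split; apply: integral_ge0 => x _.
have [G10 G20] : 0 <= G1 /\ 0 <= G2.
  by split; apply: integral_ge0 => x _; exact: gE0.
move=> [P10 P20 N10 N20] IG K1 K2 KL20 KL10 N1lt I2 I1.
have G1fin : G1 \is a fin_num.
  apply: (@fin_num_ge0_addlty l1 _ (l2%:E * G2)) => //.
    by rewrite mule_ge0// lee_fin ltW.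
  by rewrite -IG ltry.
have G2fin : G2 \is a fin_num.
  apply: (@fin_num_ge0_addlty l2 _ (l1%:E * G1)) => //.
    by rewrite mule_ge0// lee_fin ltW.
  by rewrite addeC -IG ltry.
have N1fin : N1 \is a fin_num.
  apply: (@fin_num_ge0_addlty l1 _ (l2%:E * N2)) => //.
    by rewrite mule_ge0// lee_fin ltW.
  exact: le_lt_trans N1lt (ltry _).
have N2fin : N2 \is a fin_num.
  apply: (@fin_num_ge0_addlty l2 _ (l1%:E * N1)) => //.
    by rewrite mule_ge0// lee_fin ltW.
  by rewrite addeC; exact: le_lt_trans N1lt (ltry _).
move: G1fin G2fin N1fin N2fin IG I1 I2 {N1lt N10 N20 G10 G20}.
move: G1 G2 N1 N2 => [g1| |] // [g2| |] // [n1| |] // [n2| |] // _ _ _ _.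
move: (KL mu1 nu1) KL10 K1 => [k1| |] // _ _.
move: (KL mu2 nu2) KL20 K2 => [k2| |] // _ _.
move: P1 P2 P10 P20 => [p1| |] // [p2| |] // _ _ [IG].
rewrite -!EFinM -!EFinD !lee_fin => /(ler_wpM2l (ltW l10)) I1.
by move=> /(ler_wpM2l (ltW l20)) I2; lra.
Qed.

End kullback_leibler.

(** * Small divergence forces close integrals *)

Section integral_closeness.
Context d (T : measurableType d) (R : realType).
Implicit Types (mu nu : probability T R) (h : T -> R).

Lemma integrable_bounded mu h (M : R) : measurable_fun setT h ->
  (forall x, `|h x| <= M) -> mu.-integrable setT (EFin \o h).
Proof.
move=> mh hM; apply: measurable_bounded_integrable => //.
- by apply: (le_lt_trans (probability_le1 mu measurableT)); rewrite ltry.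
- exists M; split; first by rewrite num_real.
  by move=> y My x _; exact: le_trans (hM x) (ltW My).
Qed.

(** [gibbs_variational] for g = exp (s h), the exponential being bounded by
    [expR_le_quadratic]. *)
Lemma exponential_tilting_bound mu nu h (M s k : R) : measurable_fun setT h ->
  (forall x, `|h x| <= M) -> 0 < s -> s * M <= 2^-1 -> KL mu nu = k%:E ->
  s * \int[mu]_x h x <= k + s * \int[nu]_x h x + 2 * (s * M) ^+ 2.
Proof.
move=> mh hM s0 sM KLk.
pose f x := s * h x.
have mf : measurable_fun setT f by exact: measurable_funM.
have fM x : `|f x| <= s * M by rewrite normrM gtr0_norm// ler_pM2l.
have intf (m : probability T R) : m.-integrable setT (EFin \o f) :=
  integrable_bounded m mf fM.
have RE (m : probability T R) : \int[m]_x f x = s * \int[m]_x h x.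
  by rewrite RintegralZl//; exact: integrable_bounded hM.
have mg : measurable_fun setT (fun x => expR (f x)) by exact: measurableT_comp.
have eN0 x : expR (f x) != 0 by rewrite gt_eqF// expR_gt0.
have := @gibbs_variational _ _ _ mu nu _ mg (fun x => expR_ge0 (f x)).
rewrite (_ : _ @^-1` _ = set0); last first.
  by apply/seteqP; split => x //= /eqP; rewrite (negbTE (eN0 x)).
move=> /(_ (measure0 mu)).
have : (\int[mu]_x (f x)%:E = \int[mu]_x (Num.max (ln (expR (f x))) 0)%:E -
    \int[mu]_x (Num.max (- ln (expR (f x))) 0)%:E)%E.
  by rewrite -(integral_lnE mu mg); apply: eq_integral => x _; rewrite expRK.
rewrite KLk.
have intg : nu.-integrable setT (EFin \o (fun x => expR (f x))).
  apply: (@integrable_bounded _ _ (expR (s * M))) => // x.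
  rewrite ger0_norm ?expR_ge0// ler_expR.
  exact: le_trans (ler_norm _) (fM x).
have le_g : \int[nu]_x expR (f x) <= 1 + s * \int[nu]_x h x + 2 * (s * M) ^+ 2.
  pose c : R := 1 + 2 * (s * M) ^+ 2.
  have intc : nu.-integrable setT (EFin \o cst c).
    exact: finite_measure_integrable_cst.
  have -> : 1 + s * \int[nu]_x h x + 2 * (s * M) ^+ 2 = \int[nu]_x (cst c x + f x).
    have cE : \int[nu]_x cst c x = c.
      apply: (etrans (Rintegral_cst nu measurableT c)).
      by rewrite (congr1 fine (probability_setT nu)) mulr1.
    apply/esym/(etrans (RintegralD measurableT intc (intf nu))).
    by apply: (etrans (congr2 +%R cE (RE nu))); rewrite /c; lra.
  apply: le_Rintegral => //.
    have -> : EFin \o (fun x => cst c x + f x) = ((EFin \o cst c) \+ (EFin \o f))%E.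
      by apply/funext.
    exact: (integrableD measurableT intc (intf nu)).
  move=> x _; have := expR_le_quadratic (le_trans (fM x) sM).
  have : f x ^+ 2 <= (s * M) ^+ 2.
    rewrite -real_normK ?num_real// lerXn2r// nnegrE//.
    exact: le_trans (fM x).
  by rewrite /c/=; lra.
move: le_g; rewrite -!RE /Rintegral.
move: (integrable_fin_num measurableT intg).
move: (integrable_fin_num measurableT (intf mu)) => /=.
case: (\int[mu]_x (f x)%:E)%E => // m _.
case: (\int[nu]_x (expR (f x))%:E)%E => // n _ /= le_g.
move: (\int[mu]_x (Num.max (ln _) _)%:E)%E (\int[mu]_x (Num.max (- _) _)%:E)%E.
move=> [p| |] // [q| |] //=.
by rewrite -!EFinD lee_fin => -[mE] ?; lra.
Qed.

(** Dividing [exponential_tilting_bound] by s, for both h and - h, bounds the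
    difference by KL / s + 2 s M^2. The scale s is chosen so that the second term
    is at most e / 4, and then eta so that the first is below e / 2. *)
Lemma KL_small_integral_close mu (M e : R) : 0 < M -> 0 < e ->
  exists2 eta : R, 0 < eta & forall nu h, measurable_fun setT h ->
    (forall x, `|h x| <= M) -> (KL mu nu < eta%:E)%E ->
    `|\int[mu]_x h x - \int[nu]_x h x| < e.
Proof.
move=> M0 e0; pose s := Num.min (2^-1 / M) (e / (8 * M ^+ 2)).
have s0 : 0 < s by rewrite lt_min !divr_gt0// mulr_gt0// exprn_gt0.
have sM : s * M <= 2^-1 by rewrite -ler_pdivlMr// ge_min lexx.
have sM2 : 2 * (s * M) ^+ 2 <= s * e / 4.
  have : s <= e / (8 * M ^+ 2) by rewrite ge_min lexx orbT.
  rewrite ler_pdivlMr; last by rewrite mulr_gt0// exprn_gt0.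
  move=> /(ler_wpM2l (ltW s0)); lra.
exists (s * e / 2); first by rewrite divr_gt0// mulr_gt0.
move=> nu h mh hM KLlt.
have [k KLk kpos] : exists2 k, KL mu nu = k%:E & k < s * e / 2.
  move: (KL mu nu) (KL_ge0 mu nu) KLlt => [k| |]//= _; rewrite lte_fin => ?.
  by exists k.
have H1 := exponential_tilting_bound mh hM s0 sM KLk.
have mNh : measurable_fun setT (fun x => - h x) by exact: measurableT_comp.
have hNM x : `|- h x| <= M by rewrite normrN.
have H2 := exponential_tilting_bound mNh hNM s0 sM KLk.
have NE (m : probability T R) : \int[m]_x (- h x) = - \int[m]_x h x.
  rewrite -[RHS]mulN1r -RintegralZl//; last exact: integrable_bounded hM.
  by apply: eq_Rintegral => x _; rewrite mulN1r.
rewrite !NE in H2.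
have : s * `|\int[mu]_x h x - \int[nu]_x h x| < s * e.
  rewrite -{1}(gtr0_norm s0) -normrM ltr_norml mulrBr.
  by apply/andP; split; lra.
by rewrite ltr_pM2l.
Qed.

End integral_closeness.

(** * Weakly compact sets of measures *)

Section weak_topology.
Context {R : realType} {X : ptopologicalType}.
Implicit Types (mu nu : borelProb R X) (f : X -> R^o) (O : set X).

Lemma continuous_borel_measurable f :
  continuous f -> measurable_fun setT (f : borel X -> R).
Proof.
move=> /continuousP cf; apply: (measurability _ (RGenOpens.measurableE R)).
move=> _ [_ [a [b ->]] <-]; rewrite setTI; apply: sub_sigma_algebra.
exact/cf/interval_open.
Qed.

Section distance_function.
Context (dist : X -> X -> R).
Context (dist_ge0 : forall x y, 0 <= dist x y).
Context (distC : forall x y, dist x y = dist y x).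
Context (dist_triangle : forall x y z, dist x z <= dist x y + dist y z).
Context (distxx : forall x, dist x x = 0).
Context (dist_nbhs : forall (x : X) (A : set X), nbhs x A <->
  exists2 e : R, 0 < e & [set y | dist x y < e] `<=` A).

Definition dist_to (A : set X) (x : X) : R := inf [set dist x y | y in A].

Lemma dist_to_le (A : set X) x y : A y -> dist_to A x <= dist x y.
Proof.
move=> Ay; apply: ge_inf; last by exists y.
by exists 0 => _ [z _ <-].
Qed.

Lemma dist_to_ge (A : set X) x r : A !=set0 ->
  (forall y, A y -> r <= dist x y) -> r <= dist_to A x.
Proof.
move=> [a Aa] h; apply: lb_le_inf; first by exists (dist x a), a.
by move=> _ [y Ay <-]; exact: h.
Qed.

Lemma dist_to_lipschitz (A : set X) x y : A !=set0 ->
  `|dist_to A x - dist_to A y| <= dist x y.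
Proof.
move=> A0; have half u v : dist_to A u - dist u v <= dist_to A v.
  apply: dist_to_ge => // z Az.
  have := dist_to_le u Az; have := dist_triangle u v z; lra.
have := half x y; have := half y x; rewrite (distC y) => h1 h2.
by rewrite ler_norml; apply/andP; split; lra.
Qed.

Lemma dist_to_gt0 O x : open O -> ~` O !=set0 -> O x -> 0 < dist_to (~` O) x.
Proof.
move=> oO O0 Ox; have /dist_nbhs[e e0 eO] : nbhs x O by exact: open_nbhs_nbhs.
apply: (lt_le_trans e0); apply: dist_to_ge => // y Oy.
by rewrite leNgt; apply/negP => /eO.
Qed.

Lemma dist_to_eq0 (A : set X) x : A x -> dist_to A x = 0.
Proof.
move=> Ax; apply/eqP; rewrite eq_le -{1}(distxx x) dist_to_le//=.
by apply: dist_to_ge; [exists x|].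
Qed.

(** A truncation of n times the distance to the complement of O; for O open with
    nonempty complement, these continuous functions increase to the indicator of
    O as n grows. *)
Definition bump O (n : nat) (x : X) : R := Num.min 1 (n%:R * dist_to (~` O) x).

Lemma bump_ge0 O n x : ~` O !=set0 -> 0 <= bump O n x.
Proof.
by move=> O0; rewrite le_min ler01 mulr_ge0//; exact: dist_to_ge.
Qed.

Lemma bump_le1 O n x : bump O n x <= 1.
Proof. by rewrite ge_min lexx. Qed.

Lemma bump_continuous O n : ~` O !=set0 -> continuous (bump O n : X -> R^o).
Proof.
move=> O0 x; apply/cvgrPdist_lt => e e0.
apply/dist_nbhs; exists (e / n.+1%:R); first by rewrite divr_gt0.
move=> y /=; rewrite ltr_pdivlMr// => xy.
apply: le_lt_trans xy.
apply: (@le_trans _ _ (n%:R * `|dist_to (~` O) x - dist_to (~` O) y|)); last first.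
  rewrite mulrC ler_pM ?dist_to_lipschitz// ler_nat//.
rewrite -[n%:R](@ger0_norm R)// -normrM mulrBr /bump.
case: (leP 1 (_ * dist_to _ x)) => hx; case: (leP 1 (_ * dist_to _ y)) => hy.
- by rewrite subrr normr0.
- by rewrite !ger0_norm; lra.
- by rewrite -normrN -[leRHS]normrN !ger0_norm; lra.
- by [].
Qed.

Lemma bump_nondecreasing O x : ~` O !=set0 ->
  {homo (fun n => bump O n x) : m n / (m <= n)%N >-> m <= n}.
Proof.
move=> O0 m n mn; rewrite /bump le_min ge_min lexx/= ge_min.
by rewrite ler_wpM2r ?orbT ?ler_nat//; exact: dist_to_ge.
Qed.

Lemma bump_cvg O x : open O -> ~` O !=set0 ->
  (bump O n x)%:E @[n --> \oo] --> ((\1_O x)%:E : \bar R).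
Proof.
move=> oO O0; apply: cvg_near_cst.
have [Ox|Ox] := pselect (O x); last first.
  apply: nearW => n.
  by rewrite /bump dist_to_eq0// mulr0 indicE memNset// min_r.
have d0 := dist_to_gt0 oO O0 Ox.
near=> n; rewrite indicE mem_set// /bump min_l//.
rewrite -ler_pdivrMr// div1r; near: n.
exact: nbhs_infty_ger.
Unshelve. all: by end_near. Qed.

End distance_function.

(** The integrals of the bumps determine the measure of every open set by
    monotone convergence, and the open sets are a pi-system generating the Borel
    sigma-algebra. The complement of O must be nonempty for the distance to it to
    make sense; otherwise O has measure 1. *)
Lemma borelProb_eq_bounded_continuous (hX : polish_space R X) mu nu :
  (forall f, continuous f -> bounded_fun f ->
     Rintegral mu setT f = Rintegral nu setT f) -> mu = nu.
Proof.
move=> H; case: hX => -[dist [[d0 dxx] dC dT dN _]] _.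
have dist0 x : dist x x = 0 by exact/dxx.
have eqO (O : set X) : open O -> mu O = nu O.
  move=> oO; have [ O0|/set0P O0] := eqVneq (~` O) set0.
    rewrite -[ O]setCK O0 setC0.
    exact: etrans (probability_setT mu) (esym (probability_setT nu)).
  have mO : @measurable _ (borel X) O by exact: sub_sigma_algebra.
  have cb n : continuous (bump dist O n : X -> R^o).
    exact: (bump_continuous d0 dC dT dN).
  have mb n : measurable_fun setT (bump dist O n : borel X -> R).
    exact: continuous_borel_measurable.
  have b0 n x : 0 <= bump dist O n x by exact: bump_ge0.
  have bN n x : `|bump dist O n x| <= 1 by rewrite ger0_norm ?b0 ?bump_le1.
  have intE (m : borelProb R X) :
      (\int[m]_x (bump dist O n x)%:E)%E @[n --> \oo] --> m O.
    have := @cvg_monotone_convergence _ (borel X) R m setT measurableT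
      (fun n x => (bump dist O n x)%:E).
    have -> : (\int[m]_x limn (fun n => (bump dist O n x)%:E) = m O)%E.
      rewrite -[in RHS](setIT O) -integral_indic//.
      apply: eq_integral => x _; apply/cvg_lim => //.
      exact: (bump_cvg d0 dist0 dN).
    apply.
    - by move=> n; exact/measurable_EFinP.
    - by move=> n x _; rewrite lee_fin.
    - by move=> x _ a b ab; rewrite lee_fin; exact: bump_nondecreasing.
  apply: (cvg_unique _ (intE mu)) => //.
  have -> : (fun n => \int[mu]_x (bump dist O n x)%:E)%E =
            (fun n => \int[nu]_x (bump dist O n x)%:E)%E.
    apply/funext => n.
    have := H _ (cb n).
    have fin (m : borelProb R X) : (\int[m]_x (bump dist O n x)%:E)%E \is a fin_num.
      exact/integrable_fin_num/(integrable_bounded m (mb n) (bN n)).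
    rewrite -(fineK (fin mu)) -(fineK (fin nu)) => h; congr (_%:E); apply: h.
    exists 1; split; first by rewrite num_real.
    by move=> r r1 x _; exact: le_trans (bN n x) (ltW r1).
  exact: intE.
apply: borelProb_ext => A mA.
apply: (@g_sigma_algebra_measure_unique _ R (borel X) (@open X) _
  (fun=> setT) _ _ mu nu) => //.
- exact: sub_sigma_algebra.
- by move=> _; exact: openT.
- by rewrite bigcup_const//; exists 0%N.
- exact: openI.
- by move=> _; apply: (le_lt_trans (probability_le1 mu measurableT)); rewrite ltry.
Qed.

(** The measures of Q with divergence from mu below eta, for eta > 0, generate a
    proper filter; mu is equal to any of its cluster points. *)
Lemma compact_KL_mem (hX : polish_space R X) (Q : set (borelProb R X)) mu :
  compact Q ->
  (forall eta : R, 0 < eta -> exists2 nu, Q nu & (KL mu nu < eta%:E)%E) ->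
  Q mu.
Proof.
move=> cQ approx.
pose B (eta : R) := [set nu : borelProb R X | Q nu /\ (KL mu nu < eta%:E)%E].
pose F := filter_from [set eta : R | 0 < eta] B.
have FF : ProperFilter F.
  apply: filter_from_proper; last first.
    by move=> eta /approx[nu Qnu KLnu]; exists nu.
  apply: filter_from_filter; first by exists 1 => /=.
  move=> i j i0 j0; exists (Num.min i j); first by rewrite /= lt_min i0 j0.
  by move=> nu [Qnu]; rewrite EFin_min lt_min => /andP[? ?]; split; split.
have FQ : F Q by exists 1 => [//=|nu []].
have [nu [Qnu clnu]] := cQ F FF FQ.
suff -> : mu = nu by [].
apply: (borelProb_eq_bounded_continuous hX) => f cf bf.
have mf := continuous_borel_measurable cf.
have [M M0 fM] : exists2 M : R, 0 < M & forall x, `|f x| <= M.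
  have [M [_ hM]] := bf.
  exists (`|M| + 1); first by rewrite ltr_wpDl.
  by move=> x; apply: hM => //; rewrite ltr_pwDr// ler_norm.
apply/eqP; rewrite -subr_eq0 -normr_le0; apply/ler_addgt0Pr => e e0.
rewrite add0r.
have e20 : 0 < e / 2 by rewrite divr_gt0.
have [eta eta0 close] := @KL_small_integral_close _ (borel X) R mu M (e / 2) M0 e20.
have near_nu : nbhs nu [set nu' : borelProb R X |
    `|Rintegral nu setT f - Rintegral nu' setT f| < e / 2].
  have := (weak_cvgP nu (nbhs_filter nu)).1 (fun A => id) f cf bf.
  by move=> /cvgrPdist_lt/(_ _ e20).
have FB : F (B eta) by exists eta.
have [nu' [[Qnu' KLnu'] nunu']] := clnu _ _ FB near_nu.
have := close nu' f mf fM KLnu'.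
have -> : Rintegral mu setT f - Rintegral nu setT f =
  (Rintegral mu setT f - Rintegral nu' setT f) -
  (Rintegral nu setT f - Rintegral nu' setT f) by lra.
move: nunu' => /= h1 h2; apply: (le_trans (ler_normB _ _)); lra.
Qed.

End weak_topology.

(** * Divergence of sets of measures *)

Section KL_sets.
Context {R : realType} {X : ptopologicalType}.
Implicit Types (mu nu : borelProb R X) (P Q : set (borelProb R X)).
Local Open Scope ereal_scope.

Lemma KL_set_ge0 P Q : P !=set0 -> 0 <= KL_set P Q.
Proof.
move=> [mu Pmu]; apply: (@le_trans _ _ (ereal_inf [set KL mu nu | nu in Q])).
  by apply: le_ereal_inf_tmp => _ [nu _ <-]; exact: KL_ge0.
by apply: ereal_sup_ubound; exists mu.
Qed.

Lemma KL_set_subr P Q1 Q2 : Q1 `<=` Q2 -> KL_set P Q2 <= KL_set P Q1.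
Proof.
move=> Q12; apply: ge_ereal_sup => _ [mu Pmu <-].
apply: (@le_trans _ _ (ereal_inf [set KL mu nu | nu in Q1])).
  by apply: ereal_inf_le_tmp; exact: image_subset.
by apply: ereal_sup_ubound; exists mu.
Qed.

Lemma KL_set_subl P1 P2 Q : P1 `<=` P2 -> KL_set P1 Q <= KL_set P2 Q.
Proof. by move=> P12; apply: ereal_sup_le; exact: image_subset. Qed.

Lemma KL_set_lt_witness P Q mu (r : \bar R) : P mu -> KL_set P Q < r ->
  exists2 nu, Q nu & KL mu nu < r.
Proof.
move=> Pmu PQr.
have /ereal_inf_lt[_ [nu Qnu <-] ?] : ereal_inf [set KL mu nu | nu in Q] < r.
  by apply: le_lt_trans PQr; apply: ereal_sup_ubound; exists mu.
by exists nu.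
Qed.

Lemma KL_set_eq0 (hX : polish_space R X) P Q : P !=set0 -> compact Q ->
  KL_set P Q = 0 <-> P `<=` Q.
Proof.
move=> P0 cQ; split => [PQ0 mu Pmu|PQ].
  apply: (compact_KL_mem hX cQ) => eta eta0.
  by apply: (KL_set_lt_witness Pmu); rewrite PQ0 lte_fin.
apply/eqP; rewrite eq_le KL_set_ge0// andbT.
apply: ge_ereal_sup => _ [mu Pmu <-]; rewrite -(KLxx mu).
by apply: ereal_inf_lbound; exists mu => //; exact: PQ.
Qed.

Lemma mixtureC (l1 l2 : R) P1 P2 : mixture l1 l2 P1 P2 = mixture l2 l1 P2 P1.
Proof.
by apply/seteqP; split => mu [m1 Pm1 [m2 Pm2 E]];
  exists m2 => //; exists m1 => // A; rewrite E addeC.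
Qed.

Lemma mixture1 P1 P2 : P2 !=set0 -> mixture 1 0 P1 P2 = P1.
Proof.
move=> [p2 Pp2]; apply/seteqP; split => mu.
  move=> [m1 Pm1 [m2 _ E]]; rewrite (_ : mu = m1)//.
  by apply: borelProb_ext => A _; rewrite E mul1e mul0e adde0.
move=> Pmu; exists mu => //; exists p2 => // A.
by rewrite mul1e mul0e adde0.
Qed.

(** Mixing near-optimal nu1 in Q1 and nu2 in Q2 for the components mu1, mu2 of mu
    gives a competitor for mu, to which [KL_jointly_convex] applies. *)
Lemma KL_set_convex_pos P1 P2 Q1 Q2 (l1 l2 : R) :
  P1 !=set0 -> P2 !=set0 -> (0 < l1)%R -> (0 < l2)%R -> (l1 + l2 = 1)%R ->
  KL_set (mixture l1 l2 P1 P2) (mixture l1 l2 Q1 Q2) <=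
  l1%:E * KL_set P1 Q1 + l2%:E * KL_set P2 Q2.
Proof.
move=> P10 P20 l10 l20 l12.
apply: ge_ereal_sup => _ [mu [mu1 Pmu1 [mu2 Pmu2 muE]] <-].
have K10 := KL_set_ge0 Q1 P10; have K20 := KL_set_ge0 Q2 P20.
have := @KL_set_lt_witness P1 Q1 mu1; have := @KL_set_lt_witness P2 Q2 mu2.
move: (KL_set P1 Q1) (KL_set P2 Q2) K10 K20 => [k1| |] // [k2| |] // _ _; last 3 first.
- by rewrite gt0_muley ?lte_fin// addey ?leey.
- by rewrite gt0_muley ?lte_fin// addye ?leey.
- by rewrite !gt0_muley ?lte_fin// addye ?leey.
move=> w2 w1; apply/lee_addgt0Pr => e e0.
have [nu1 Qnu1 KL1] : exists2 nu, Q1 nu & KL mu1 nu < (k1 + e)%:E.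
  by apply: w1 => //; rewrite lte_fin ltrDl.
have [nu2 Qnu2 KL2] : exists2 nu, Q2 nu & KL mu2 nu < (k2 + e)%:E.
  by apply: w2 => //; rewrite lte_fin ltrDl.
have [nu [_ -> [_ -> nuE]]] := mixture_exists nu1 nu2 (ltW l10) (ltW l20) l12.
apply: (@le_trans _ _ (KL mu nu)).
  apply: ereal_inf_lbound; exists nu => //.
  by exists nu1 => //; exists nu2.
apply: (le_trans
  (KL_jointly_convex l10 l20 l12 (fun A _ => muE A) (fun A _ => nuE A))).
have -> : l1%:E * k1%:E + l2%:E * k2%:E + e%:E =
    l1%:E * (k1 + e)%:E + l2%:E * (k2 + e)%:E.
  rewrite -!EFinM -!EFinD; congr (_%:E).
  by rewrite -[in LHS](mul1r e) -l12; ring.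
by apply: leeD; apply: lee_wpmul2l; rewrite ?lee_fin ltW.
Qed.

Lemma KL_set_convex P1 P2 Q1 Q2 (l1 l2 : R) :
  P1 !=set0 -> P2 !=set0 -> Q1 !=set0 -> Q2 !=set0 ->
  (0 <= l1)%R -> (0 <= l2)%R -> (l1 + l2 = 1)%R ->
  KL_set (mixture l1 l2 P1 P2) (mixture l1 l2 Q1 Q2) <=
  l1%:E * KL_set P1 Q1 + l2%:E * KL_set P2 Q2.
Proof.
move=> P10 P20 Q10 Q20.
rewrite le_eqVlt => /predU1P[<- _|l10].
  rewrite add0r => ->.
  by rewrite !(mixtureC 0) !mixture1// mul0e mul1e add0e.
rewrite le_eqVlt => /predU1P[<-|l20 l12]; last exact: KL_set_convex_pos.
by rewrite addr0 => ->; rewrite !mixture1// mul0e mul1e adde0.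
Qed.

End KL_sets.

Theorem proposition5 (R : realType) (X : ptopologicalType)
    (hX : polish_space R X) (P Q : set (borelProb R X))
    (hP : weakly_compact_convex P) (hQ : weakly_compact_convex Q) :
  (0 <= KL_set P Q)%E /\
  (KL_set P Q = 0%E <-> P `<=` Q) /\
  (KL_set P Q = 0%E /\ KL_set Q P = 0%E <-> P = Q) /\
  ((forall Q1 Q2 : set (borelProb R X),
      weakly_compact_convex Q1 -> weakly_compact_convex Q2 ->
      Q1 `<=` Q2 -> (KL_set P Q1 >= KL_set P Q2)%E) /\
   (forall P1 P2 : set (borelProb R X),
      weakly_compact_convex P1 -> weakly_compact_convex P2 ->
      P1 `<=` P2 -> (KL_set P2 Q >= KL_set P1 Q)%E)) /\
  (forall P1 P2 Q1 Q2 : set (borelProb R X),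
     weakly_compact_convex P1 -> weakly_compact_convex P2 ->
     weakly_compact_convex Q1 -> weakly_compact_convex Q2 ->
   forall l1 l2 : R, 0 <= l1 <= 1 -> 0 <= l2 <= 1 -> l1 + l2 = 1 ->
     (KL_set (mixture l1 l2 P1 P2) (mixture l1 l2 Q1 Q2) <=
      l1%:E * KL_set P1 Q1 + l2%:E * KL_set P2 Q2)%E).
Proof.
have [P0 cP _] := hP; have [Q0 cQ _] := hQ.
split; first exact: KL_set_ge0.
split; first exact: KL_set_eq0.
split.
  split=> [[/(KL_set_eq0 hX P0 cQ) PQ /(KL_set_eq0 hX Q0 cP) QP]|PQ].
    exact/seteqP.
  by split; apply/KL_set_eq0 => //; rewrite PQ.
split.
  split=> [Q1 Q2 _ _|P1 P2 _ _]; [exact: KL_set_subr|exact: KL_set_subl].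
move=> P1 P2 Q1 Q2 [P10 _ _] [P20 _ _] [Q10 _ _] [Q20 _ _] l1 l2.
by move=> /andP[l10 _] /andP[l20 _] l12; exact: KL_set_convex.
Qed.
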